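(* Let $M$ be a hyperkähler manifold, let $f\in\mathscr{A}^0(M,\mathbb{C})$ be a smooth complex-valued function on $M$, and let $\mathbf{u}\in S^2$ (with complex coordinates $\zeta$, resp. $\tilde\zeta=1/\zeta$, wherever defined). Then, on any given domain of $M$: (1) if $\mathbf{u}\in N$: $f$ is holomorphic with respect to $I(\mathbf{u})$ on the domain if and only if $df\,P_N(\zeta)=0$ on it; (2) if $\mathbf{u}\in S$: $f$ is holomorphic with respect to $I(\mathbf{u})$ on the domain if and only if $df\,P_S(\tilde\zeta)=0$ on it; (3) if $\mathbf{u}\in N\cap S$: $f$ is holomorphic with respect to $I(\mathbf{u})$ on the domain if and only if $df\,I(\zeta)=0$ on it.
   Context: A hyperkähler manifold is a smooth manifold $M$ of real dimension $4m$ with three symplectic forms $\omega_1,\omega_2,\omega_3$ such that, viewing 2-forms as bundle maps $TM\to T^*M$, the endomorphisms $I_1=\omega_3^{-1}\omega_2$, $I_2=\omega_1^{-1}\omega_3$, $I_3=\omega_2^{-1}\omega_1$ of $TM$ satisfy $I_1^2=I_2^2=I_3^2=I_1I_2I_3=-1$; the metric $g$ is given by $\omega_i(X,Y)=g(X,I_iY)$, $i=1,2,3$. For $\mathbf{u}=(x_1,x_2,x_3)\in S^2\subset\mathbb{R}^3$, $I(\mathbf{u})=x_1I_1+x_2I_2+x_3I_3$ is an integrable complex structure on $M$. Endomorphisms of $TM$ (extended complex-linearly) act on vector fields from the left and on 1-forms from the right, $(\alpha I)(X)=\alpha(IX)$. Put $I_+=\tfrac12(I_1+iI_2)$, $I_0=I_3$,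 $I_-=-\tfrac12(I_1-iI_2)$. $S^2$ is covered by $N=S^2\setminus\{(0,0,-1)\}$ and $S=S^2\setminus\{(0,0,1)\}$, with complex coordinates $\zeta=-\frac{x_1+ix_2}{1+x_3}$ on $N$ and $\tilde\zeta=-\frac{x_1-ix_2}{1-x_3}$ on $S$, so $\tilde\zeta=1/\zeta$ on $N\cap S$. Define sections of $\mathrm{End}(T_{\mathbb{C}}M)$: $P_N(\zeta)=\tfrac12(1+iI_0)+i\zeta I_-$ for $\mathbf{u}\in N$; $P_S(\tilde\zeta)=\tfrac12(1-iI_0)-i\tilde\zeta I_+$ for $\mathbf{u}\in S$; and $I(\zeta)=\frac{I_+}{\zeta}+I_0+\zeta I_-=i[P_S(\tilde\zeta)-P_N(\zeta)]$ for $\mathbf{u}\in N\cap S$. *)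

(* Defs.v *)
From HB Require Import structures.
From mathcomp Require Import all_boot all_order all_algebra.
From mathcomp Require Import complex.
From mathcomp Require Import all_classical all_reals all_analysis.
Set Implicit Arguments.
Unset Strict Implicit.
Unset Printing Implicit Defensive.
Import Order.TTheory GRing.Theory Num.Theory.
Import numFieldNormedType.Exports.
Local Open Scope classical_set_scope.
Local Open Scope ring_scope.
Local Open Scope complex_scope.

Section Calculus.
Context {R : realType} {n : nat}.

Definition partial (j : 'I_n) (f : 'cV[R]_n -> R) (x : 'cV[R]_n) : R :=
  'D_(delta_mx j 0) f x.

Fixpoint Ck_on (k : nat) (A : set 'cV[R]_n) (f : 'cV[R]_n -> R) : Prop :=
  match k with
  | 0 => forall x, A x -> {for x, continuous f}
  | k'.+1 => forall j : 'I_n,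
      (forall x, A x -> derivable f x (delta_mx j 0)) /\ Ck_on k' A (partial j f)
  end.

Definition smooth_on (A : set 'cV[R]_n) (f : 'cV[R]_n -> R) : Prop :=
  forall k, Ck_on k A f.

Definition jacobi_mx (F : 'cV[R]_n -> 'cV[R]_n) (x : 'cV[R]_n) : 'M[R]_n :=
  \matrix_(i, j) partial j (fun y => F y i 0) x.

End Calculus.

(* [chart_inv] is total; only its values on [chart_im c] matter. *)
Record chart (R : realType) (n : nat) (M : topologicalType) := Chart {
  chart_dom : set M;
  chart_map : M -> 'cV[R]_n;
  chart_inv : 'cV[R]_n -> M;
  chart_dom_open : open chart_dom;
  chart_im_open : open (chart_map @` chart_dom);
  chart_map_cont : {within chart_dom, continuous chart_map};
  chart_inv_cont : {within chart_map @` chart_dom, continuous chart_inv};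
  chart_mapK : {in chart_dom, cancel chart_map chart_inv} }.

Definition chart_im (R : realType) (n : nat) (M : topologicalType)
  (c : chart R n M) : set 'cV[R]_n := chart_map c @` chart_dom c.

(* The atlas is {chart_at p | p : M}; every smooth structure is generated by an
   atlas of this form. *)
Record manifold (R : realType) (n : nat) := Manifold {
  carrier :> topologicalType;
  carrier_hausdorff : hausdorff_space carrier;
  carrier_second_countable : @second_countable carrier;
  chart_at : carrier -> chart R n carrier;
  chart_at_dom : forall p, chart_dom (chart_at p) p;
  chart_at_smooth : forall (p q : carrier) (i : 'I_n),
    smooth_on (chart_map (chart_at p) @`
                 (chart_dom (chart_at p) `&` chart_dom (chart_at q)))
      (fun x => chart_map (chart_at q) (chart_inv (chart_at p) x) i 0) }.

(* The tangent space T_pM is 'cV[R]_n, a tangent vector being given by its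
   components in the chart [chart_at p].  Covectors are rows, endomorphisms of
   T_pM are matrices X |-> A *m X, and alpha *m A is the covector
   X |-> alpha (A X).  A bilinear form B on T_pM is its Gram matrix,
   B(X, Y) = X^T *m B *m Y. *)

Section Tensors.
Context {R : realType} {n : nat} (M : manifold R n).

(* Column j is the coordinate vector d/dx_j of the chart c at the point of
   coordinates x, as an element of the tangent space at that point. *)
Definition coord_frame (c : chart R n M) (x : 'cV[R]_n) : 'M[R]_n :=
  jacobi_mx (fun y => chart_map (chart_at (chart_inv c x)) (chart_inv c y)) x.

Definition coord_form (c : chart R n M) (B : M -> 'M[R]_n) (x : 'cV[R]_n) :
  'M[R]_n :=
  (coord_frame c x)^T *m B (chart_inv c x) *m coord_frame c x.

Definition smooth_form (B : M -> 'M[R]_n) : Prop :=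
  forall (p : M) (i j : 'I_n), smooth_on (chart_im (chart_at p))
    (fun x => coord_form (chart_at p) B x i j).

Definition closed_2form (w : M -> 'M[R]_n) : Prop :=
  forall (p : M) (x : 'cV[R]_n) (i j k : 'I_n),
    let w_ i j y := coord_form (chart_at p) w y i j in
    chart_im (chart_at p) x ->
    partial i (w_ j k) x + partial j (w_ k i) x + partial k (w_ i j) x = 0.

Record symplectic (w : M -> 'M[R]_n) : Prop := Symplectic {
  symplectic_alt : forall p, (w p)^T = - w p;
  symplectic_smooth : smooth_form w;
  symplectic_closed : closed_2form w;
  symplectic_nondeg : forall p, w p \in unitmx }.

Record riemannian (g : M -> 'M[R]_n) : Prop := Riemannian {
  riemannian_sym : forall p, (g p)^T = g p;
  riemannian_smooth : smooth_form g;
  riemannian_pos : forall p (X : 'cV[R]_n), X != 0 ->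
    0 < (X^T *m g p *m X) 0 0 }.

Definition smooth_fun (f : M -> R[i]) : Prop :=
  forall p : M,
    smooth_on (chart_im (chart_at p))
      (fun x => complex.Re (f (chart_inv (chart_at p) x))) /\
    smooth_on (chart_im (chart_at p))
      (fun x => complex.Im (f (chart_inv (chart_at p) x))).

Definition differential_at (f : M -> R[i]) (p : M) : 'rV[R[i]]_n :=
  let x := chart_map (chart_at p) p in
  \row_j (partial j (fun y => complex.Re (f (chart_inv (chart_at p) y))) x +i*
          partial j (fun y => complex.Im (f (chart_inv (chart_at p) y))) x).

Definition cplx (k l : nat) (A : 'M[R]_(k, l)) : 'M[R[i]]_(k, l) :=
  map_mx (fun a : R => a%:C) A.

(* f is holomorphic on U for the complex structure J: its differential
   (T_pM, J p) -> (C, i) is complex-linear at every p in U. *)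
Definition holomorphic_on (J : M -> 'M[R]_n) (U : set M) (f : M -> R[i]) : Prop :=
  forall p, U p -> forall X : 'cV[R]_n,
    differential_at f p *m cplx (J p *m X) =
    'i *: (differential_at f p *m cplx X).

End Tensors.

(* As a map T_pM -> T*_pM, a 2-form w is taken to be Y |-> w(., Y), with matrix
   w p; the convention X |-> w(X, .) gives - w p, hence the same I_1, I_2, I_3. *)
Definition recursion_op (R : realType) (n : nat) (M : manifold R n)
  (w w' : M -> 'M[R]_n) (p : M) : 'M[R]_n := invmx (w p) *m w' p.

Record hyperkahler (R : realType) (m : nat) (M : manifold R (4 * m)) :=
  Hyperkahler {
  omega1 : M -> 'M[R]_(4 * m);
  omega2 : M -> 'M[R]_(4 * m);
  omega3 : M -> 'M[R]_(4 * m);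
  metric : M -> 'M[R]_(4 * m);
  I1 := recursion_op omega3 omega2;
  I2 := recursion_op omega1 omega3;
  I3 := recursion_op omega2 omega1;
  omega1_symplectic : symplectic omega1;
  omega2_symplectic : symplectic omega2;
  omega3_symplectic : symplectic omega3;
  quaternion1 : forall p, I1 p *m I1 p = - 1%:M;
  quaternion2 : forall p, I2 p *m I2 p = - 1%:M;
  quaternion3 : forall p, I3 p *m I3 p = - 1%:M;
  quaternion123 : forall p, I1 p *m I2 p *m I3 p = - 1%:M;
  metric_riemannian : riemannian metric;
  metric1 : forall p, omega1 p = metric p *m I1 p;
  metric2 : forall p, omega2 p = metric p *m I2 p;
  metric3 : forall p, omega3 p = metric p *m I3 p }.

Section Sphere.
Context {R : realType}.
Implicit Type u : R * R * R.

Definition S2 : set (R * R * R) :=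
  [set u | u.1.1 ^+ 2 + u.1.2 ^+ 2 + u.2 ^+ 2 = 1].

Definition coverN : set (R * R * R) := S2 `\ (0, 0, -1).
Definition coverS : set (R * R * R) := S2 `\ (0, 0, 1).

Definition zetaN u : R[i] :=
  let: (x1, x2, x3) := u in - ((x1 +i* x2) / (1 + x3)%:C).
Definition zetaS u : R[i] :=
  let: (x1, x2, x3) := u in - ((x1 -i* x2) / (1 - x3)%:C).

End Sphere.

Section Twistor.
Context {R : realType} {m : nat} {M : manifold R (4 * m)} (H : hyperkahler M).
Local Notation End_C := 'M[R[i]]_(4 * m).

Definition complex_structure (u : R * R * R) (p : M) : 'M[R]_(4 * m) :=
  let: (x1, x2, x3) := u in x1 *: I1 H p + x2 *: I2 H p + x3 *: I3 H p.

Definition I_plus (p : M) : End_C :=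
  2^-1 *: (cplx (I1 H p) + 'i *: cplx (I2 H p)).
Definition I_zero (p : M) : End_C := cplx (I3 H p).
Definition I_minus (p : M) : End_C :=
  - (2^-1 *: (cplx (I1 H p) - 'i *: cplx (I2 H p))).

Definition P_N (z : R[i]) (p : M) : End_C :=
  2^-1 *: (1%:M + 'i *: I_zero p) + ('i * z) *: I_minus p.
Definition P_S (z : R[i]) (p : M) : End_C :=
  2^-1 *: (1%:M - 'i *: I_zero p) - ('i * z) *: I_plus p.
Definition I_zeta (z : R[i]) (p : M) : End_C :=
  z^-1 *: I_plus p + I_zero p + z *: I_minus p.

End Twistor.

(* Main.v *)
Require Import Defs.
From HB Require Import structures.
From mathcomp Require Import all_boot all_order all_algebra.
From mathcomp Require Import complex.
From mathcomp Require Import all_classical all_reals all_analysis.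
From mathcomp Require Import ring.
Set Implicit Arguments.
Unset Strict Implicit.
Unset Printing Implicit Defensive.
Import Order.TTheory GRing.Theory Num.Theory.
Import numFieldNormedType.Exports.
Local Open Scope classical_set_scope.
Local Open Scope ring_scope.
Local Open Scope complex_scope.

(** Write E(v) = 1 + i (v1 I1 + v2 I2 + v3 I3) for v in the sphere.  Since
    I(v)^2 = -1, E(v) is twice the projector onto the (0,1)-vectors of I(v), so
    f is holomorphic for I(u) exactly when df E(u) = 0 ([holomorphic_onE]).

    The quaternion relations give the compression identity
    E(u) E(v) E(u) = 2 (1 + <u, v>) E(u), whence df E(u) = 0 and
    df E(u) E(v) = 0 are equivalent unless v = -u ([proj01_kernel]).  Taking
    for v the two poles n = (0, 0, 1) and -n produces the two operators of the
    statement: E(u) E(n) = 2 (1 + x3) P_N(zeta) and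
    E(u) E(-n) = 2 (1 - x3) P_S(1/zeta); the excluded points are those where
    the scalar factor vanishes.

    Away from both poles I(zeta) = i (P_S - P_N), so that df I(zeta) = 0 follows
    from the vanishing of df E(u).  Conversely E(-n) E(n) = 0 and
    E(n)^2 = 2 E(n), so multiplying I(zeta) by E(n) on the right kills P_S and
    leaves -2i P_N: the equation df I(zeta) = 0 alone already forces
    df P_N = 0. *)

(** * Quaternionic matrix algebra *)

Section Quaternions.
Context {F : numFieldType} {n : nat} (J1 J2 J3 : 'M[F]_n).

Definition quat (a b c d : F) : 'M[F]_n :=
  a *: 1%:M + b *: J1 + c *: J2 + d *: J3.

Lemma scale_quat k a b c d :
  k *: quat a b c d = quat (k * a) (k * b) (k * c) (k * d).
Proof. by rewrite /quat !scalerDr !scalerA. Qed.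

Lemma quatB a b c d a' b' c' d' :
  quat a b c d - quat a' b' c' d' =
  quat (a - a') (b - b') (c - c') (d - d').
Proof. by apply/matrixP=> i j; rewrite !mxE; ring. Qed.

Hypotheses (J11 : J1 *m J1 = - 1%:M) (J22 : J2 *m J2 = - 1%:M)
  (J33 : J3 *m J3 = - 1%:M) (J123 : J1 *m J2 *m J3 = - 1%:M).

Lemma quat12 : J1 *m J2 = J3.
Proof.
have /(congr1 (mulmx^~ J3)) := J123.
rewrite -mulmxA J33 mulmxN mulmx1 mulNmx mul1mx; exact: oppr_inj.
Qed.

Lemma quat23 : J2 *m J3 = J1.
Proof.
have /(congr1 (mulmx J1)) := J123.
rewrite -mulmxA mulmxA J11 mulNmx mul1mx mulmxN mulmx1; exact: oppr_inj.
Qed.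

Lemma quat13 : J1 *m J3 = - J2.
Proof. by rewrite -quat12 mulmxA J11 mulNmx mul1mx. Qed.

Lemma quat21 : J2 *m J1 = - J3.
Proof. by rewrite -quat23 mulmxA J22 mulNmx mul1mx. Qed.

Lemma quat32 : J3 *m J2 = - J1.
Proof. by rewrite -quat12 -mulmxA J22 mulmxN mulmx1. Qed.

Lemma quat31 : J3 *m J1 = J2.
Proof. by rewrite -quat23 mulmxA quat32 mulNmx quat13 opprK. Qed.

Lemma mul_quat a b c d a' b' c' d' :
  quat a b c d *m quat a' b' c' d' =
  quat (a * a' - b * b' - c * c' - d * d')
       (a * b' + b * a' + c * d' - d * c')
       (a * c' - b * d' + c * a' + d * b')
       (a * d' + b * c' - c * b' + d * a').
Proof.
rewrite {1 2}/quat !mulmxDl !mulmxDr.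
rewrite -!scalemxAl -!scalemxAr !mul1mx !mulmx1.
rewrite J11 J22 J33 quat12 quat13 quat21 quat23 quat31 quat32.
by apply/matrixP=> i j; rewrite !mxE; ring.
Qed.

(** * Projectors onto (0,1)-vectors *)

Context {iota : F} (iota2 : iota ^+ 2 = -1).

(** Twice the projector onto the (0,1)-vectors of x I1 + y I2 + z I3, for
    (x, y, z) in the sphere. *)
Definition proj01 (x y z : F) : 'M[F]_n :=
  quat 1 (iota * x) (iota * y) (iota * z).

(** E(u)^2 = 2 E(u), and moving E(v) past E(u) produces, through
    I(u) I(v) + I(v) I(u) = -2 <u, v>, only the scalar product of u and v. *)
Lemma proj01_compress x y z x' y' z' :
  x ^+ 2 + y ^+ 2 + z ^+ 2 = 1 ->
  proj01 x y z *m proj01 x' y' z' *m proj01 x y z =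
  (2 * (1 + (x * x' + y * y' + z * z'))) *: proj01 x y z.
Proof.
move=> uu; have xx : x ^+ 2 = 1 - y ^+ 2 - z ^+ 2 by rewrite -uu; ring.
rewrite /proj01 !mul_quat scale_quat.
congr quat; ring: xx iota2.
Qed.

(** Right multiplication of alpha E(u) by E(v) loses nothing when v <> -u, since
    a further right multiplication by E(u) returns a nonzero multiple of
    alpha E(u). *)
Lemma proj01_kernel (alpha : 'rV[F]_n) x y z x' y' z' :
  x ^+ 2 + y ^+ 2 + z ^+ 2 = 1 -> 1 + (x * x' + y * y' + z * z') != 0 ->
  alpha *m proj01 x y z = 0 <->
  alpha *m (proj01 x y z *m proj01 x' y' z') = 0.
Proof.
move=> uu uv; split=> [a0|a0]; first by rewrite mulmxA a0 mul0mx.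
have := proj01_compress x' y' z' uu.
move=> /(congr1 (mulmx alpha)); rewrite mulmxA a0 mul0mx -scalemxAr => /esym/eqP.
by rewrite scaler_eq0 mulf_eq0 pnatr_eq0 /= (negPf uv) => /eqP.
Qed.

(** * The operators P_N, P_S and I(zeta) *)

(** Coordinates of P_N(t) in the quaternion basis; [quat_P_S] gives those of
    P_S(t). *)
Definition quatN (t : F) : 'M[F]_n :=
  quat 2^-1 (- (iota * t / 2)) (- (t / 2)) (iota / 2).

Definition quatS (t : F) : 'M[F]_n :=
  quat 2^-1 (- (iota * t / 2)) (t / 2) (- (iota / 2)).

Lemma quat_P_N t :
  2^-1 *: (1%:M + iota *: J3) +
    (iota * t) *: - (2^-1 *: (J1 - iota *: J2)) = quatN t.
Proof.
by rewrite /quatN /quat; apply/matrixP=> i j; rewrite !mxE; ring: iota2.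
Qed.

Lemma quat_P_S t :
  2^-1 *: (1%:M - iota *: J3) -
    (iota * t) *: (2^-1 *: (J1 + iota *: J2)) = quatS t.
Proof.
by rewrite /quatS /quat; apply/matrixP=> i j; rewrite !mxE; ring: iota2.
Qed.

(** The identity I(zeta) = i (P_S - P_N). *)
Lemma quat_I_zeta t :
  t^-1 *: (2^-1 *: (J1 + iota *: J2)) + J3 +
    t *: - (2^-1 *: (J1 - iota *: J2)) = iota *: (quatS t^-1 - quatN t).
Proof.
rewrite quatB scale_quat /quat; move: t^-1 => s.
by apply/matrixP=> i j; rewrite !mxE; field: iota2.
Qed.

Lemma proj01_north x y z t : t * (1 + z) = - (x + iota * y) ->
  proj01 x y z *m proj01 0 0 1 = (2 * (1 + z)) *: quatN t.
Proof.
move=> tE; have xE : x = - (t * (1 + z)) - iota * y by rewrite tE; ring.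
by rewrite mul_quat scale_quat xE; congr quat; field: iota2.
Qed.

Lemma proj01_south x y z t : t * (1 - z) = - (x - iota * y) ->
  proj01 x y z *m proj01 0 0 (-1) = (2 * (1 - z)) *: quatS t.
Proof.
move=> tE; have xE : x = - (t * (1 - z)) + iota * y by rewrite tE; ring.
by rewrite mul_quat scale_quat xE; congr quat; field: iota2.
Qed.

(** P_S is a left multiple of E(-n) and P_N one of E(n), so E(n) kills the first
    and doubles the second. *)
Lemma quatB_north s t :
  (quatS s - quatN t) *m proj01 0 0 1 = (- 2) *: quatN t.
Proof.
by rewrite quatB mul_quat scale_quat; congr quat; field: iota2.
Qed.

Lemma quatN_kernel (alpha : 'rV[F]_n) x y z t :
  x ^+ 2 + y ^+ 2 + z ^+ 2 = 1 -> 1 + z != 0 -> t * (1 + z) = - (x + iota * y) ->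
  alpha *m proj01 x y z = 0 <-> alpha *m quatN t = 0.
Proof.
move=> uu z1 tE; have uv : 1 + (x * 0 + y * 0 + z * 1) != 0.
  by rewrite !mulr0 !add0r mulr1.
rewrite (proj01_kernel alpha uu uv) (proj01_north tE) -scalemxAr.
split=> [/eqP|->]; last by rewrite scaler0.
by rewrite scaler_eq0 mulf_eq0 pnatr_eq0 (negPf z1) => /eqP.
Qed.

Lemma quatS_kernel (alpha : 'rV[F]_n) x y z t :
  x ^+ 2 + y ^+ 2 + z ^+ 2 = 1 -> 1 - z != 0 -> t * (1 - z) = - (x - iota * y) ->
  alpha *m proj01 x y z = 0 <-> alpha *m quatS t = 0.
Proof.
move=> uu z1 tE; have uv : 1 + (x * 0 + y * 0 + z * -1) != 0.
  by rewrite !mulr0 !add0r mulrN1.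
rewrite (proj01_kernel alpha uu uv) (proj01_south tE) -scalemxAr.
split=> [/eqP|->]; last by rewrite scaler0.
by rewrite scaler_eq0 mulf_eq0 pnatr_eq0 (negPf z1) => /eqP.
Qed.

(** The two stereographic coordinates of a point of the sphere are inverse to
    each other. *)
Lemma south_coordinate x y z t :
  x ^+ 2 + y ^+ 2 + z ^+ 2 = 1 -> 1 + z != 0 -> 1 - z != 0 ->
  t * (1 + z) = - (x + iota * y) -> t^-1 * (1 - z) = - (x - iota * y).
Proof.
move=> uu z1 z1' tE; have tw : t * - (x - iota * y) = 1 - z.
  apply: (mulIf z1); rewrite mulrAC tE.
  have xx : x ^+ 2 = 1 - y ^+ 2 - z ^+ 2 by rewrite -uu; ring.
  by ring: xx iota2.
have t0 : t != 0 by apply: contraNneq z1' => t0; rewrite -tw t0 mul0r.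
by rewrite -tw mulKf.
Qed.

(** The single equation alpha P_S = alpha P_N already gives alpha P_N = 0, as
    [quatB_north] shows; vanishing of alpha E(u) gives both sides zero. *)
Lemma quat_I_zeta_kernel (alpha : 'rV[F]_n) x y z t :
  x ^+ 2 + y ^+ 2 + z ^+ 2 = 1 -> 1 + z != 0 -> 1 - z != 0 ->
  t * (1 + z) = - (x + iota * y) ->
  alpha *m proj01 x y z = 0 <->
  alpha *m (iota *: (quatS t^-1 - quatN t)) = 0.
Proof.
move=> uu z1 z1' tE; have sE := south_coordinate uu z1 z1' tE.
have iota0 : iota != 0 by rewrite -sqrf_eq0 iota2 oppr_eq0 oner_eq0.
rewrite -scalemxAr; split=> [aE|/eqP].
  have /(quatN_kernel alpha uu z1 tE) aN := aE.
  have /(quatS_kernel alpha uu z1' sE) aS := aE.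
  by rewrite mulmxBr aN aS subr0 scaler0.
rewrite scaler_eq0 (negPf iota0) => /eqP aI.
apply/(quatN_kernel alpha uu z1 tE)/eqP.
have /(congr1 (mulmx alpha)) := quatB_north t^-1 t.
rewrite mulmxA aI mul0mx -scalemxAr => /esym/eqP.
by rewrite scaler_eq0 oppr_eq0 pnatr_eq0.
Qed.

End Quaternions.

(** * Tangent spaces of a hyperkähler manifold *)

Lemma cplxM (R : realType) k l r (A : 'M[R]_(k, l)) (B : 'M[R]_(l, r)) :
  cplx (A *m B) = cplx A *m cplx B.
Proof. exact: (map_mxM (real_complex R)). Qed.

Lemma cplxN1 (R : realType) k (A : 'M[R]_k) :
  A = - 1%:M -> cplx A = - 1%:M.
Proof. by move=> ->; rewrite /cplx (map_mxN (real_complex R)) map_mx1. Qed.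

(** Real tangent vectors span the complexified tangent space, so complex
    linearity of df may be tested as an identity of complex row vectors. *)
Lemma holomorphic_onE (R : realType) n (M : manifold R n) (J : M -> 'M[R]_n)
    (U : set M) (f : M -> R[i]) :
  holomorphic_on J U f <->
  forall p, U p -> differential_at f p *m (1%:M + 'i *: cplx (J p)) = 0.
Proof.
have i2 : 'i * 'i = -1 :> R[i] by rewrite -expr2 sqr_i.
split=> hol p Up; last first.
  move=> X; have := hol p Up; rewrite mulmxDr mulmx1 -scalemxAr.
  move=> /(congr1 (fun a => 'i *: (a *m cplx X))).
  rewrite mul0mx scaler0 mulmxDl scalerDr -scalemxAl scalerA i2 scaleN1r.
  by rewrite -mulmxA -cplxM => /eqP; rewrite subr_eq0 => /eqP.
have JE : differential_at f p *m cplx (J p) = 'i *: differential_at f p.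
  apply/matrixP=> a j; have := hol p Up (delta_mx j 0).
  rewrite cplxM /cplx map_delta_mx mulmxA -/(cplx (J p)) -!colE.
  by move=> /matrixP/(_ a 0); rewrite !mxE.
by rewrite mulmxDr mulmx1 -scalemxAr JE scalerA i2 scaleN1r subrr.
Qed.

Section Pointwise.
Context {R : realType} {m : nat} {M : manifold R (4 * m)} (H : hyperkahler M).
Implicit Type p : M.

Let K1 p := cplx (I1 H p).
Let K2 p := cplx (I2 H p).
Let K3 p := cplx (I3 H p).

Lemma cplxI11 p : K1 p *m K1 p = - 1%:M.
Proof. by rewrite -cplxM; apply/cplxN1/quaternion1. Qed.

Lemma cplxI22 p : K2 p *m K2 p = - 1%:M.
Proof. by rewrite -cplxM; apply/cplxN1/quaternion2. Qed.

Lemma cplxI33 p : K3 p *m K3 p = - 1%:M.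
Proof. by rewrite -cplxM; apply/cplxN1/quaternion3. Qed.

Lemma cplxI123 p : K1 p *m K2 p *m K3 p = - 1%:M.
Proof. by rewrite -!cplxM; apply/cplxN1/quaternion123. Qed.

Local Notation E p := (proj01 (K1 p) (K2 p) (K3 p) (iota := 'i)).
Lemma proj01_complex_structure (x y z : R) p :
  E p x%:C y%:C z%:C = 1%:M + 'i *: cplx (complex_structure H (x, y, z) p).
Proof.
rewrite /cplx /complex_structure !(map_mxD (real_complex R)).
rewrite !(map_mxZ (real_complex R)) !scalerDr !scalerA !addrA.
by rewrite /proj01 /quat scale1r.
Qed.

End Pointwise.

(** * The sphere *)

Lemma coverN_neq0 (R : realType) (x y z : R) : coverN (x, y, z) -> 1 + z != 0.
Proof.
case=> /= uu nS; apply/eqP=> z1; apply: nS.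
have zE : z = -1 by apply/eqP; rewrite -addr_eq0 addrC z1.
have /eqP : x ^+ 2 + y ^+ 2 = 0.
  by apply: (addIr (z ^+ 2)); rewrite uu zE sqrrN expr1n add0r.
by rewrite paddr_eq0 ?sqr_ge0 // !sqrf_eq0 zE => /andP[/eqP-> /eqP->].
Qed.

Lemma coverS_neq0 (R : realType) (x y z : R) : coverS (x, y, z) -> 1 - z != 0.
Proof.
case=> /= uu nN; apply/eqP=> z1; apply: nN.
have zE : z = 1 by apply/eqP; rewrite eq_sym -subr_eq0 z1.
have /eqP : x ^+ 2 + y ^+ 2 = 0.
  by apply: (addIr (z ^+ 2)); rewrite uu zE expr1n add0r.
by rewrite paddr_eq0 ?sqr_ge0 // !sqrf_eq0 zE => /andP[/eqP-> /eqP->].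
Qed.

Lemma zetaNE (R : realType) (x y z : R) : 1 + z != 0 ->
  zetaN (x, y, z) * (1 + z%:C) = - (x%:C + 'i * y%:C).
Proof.
move=> z1; rewrite /zetaN mulNr -[1 + z%:C](rmorphD (real_complex R)) divfK.
  by rewrite [x +i* y]complexE.
by rewrite (fmorph_eq0 (real_complex R)).
Qed.

Lemma zetaSE (R : realType) (x y z : R) : 1 - z != 0 ->
  zetaS (x, y, z) * (1 - z%:C) = - (x%:C - 'i * y%:C).
Proof.
move=> z1; rewrite /zetaS mulNr -[1 - z%:C](rmorphB (real_complex R)) divfK.
  by rewrite [x -i* y]complexE /= (rmorphN (real_complex R)) mulrN.
by rewrite (fmorph_eq0 (real_complex R)).
Qed.

Theorem proposition1 (R : realType) (m : nat) (M : manifold R (4 * m))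
  (H : hyperkahler M) (f : M -> R[i]) (f_smooth : smooth_fun f)
  (u : R * R * R) (u_S2 : S2 u) (U : set M) (U_open : open U) :
  (coverN u ->
     holomorphic_on (complex_structure H u) U f <->
     (forall p, U p -> differential_at f p *m P_N H (zetaN u) p = 0)) /\
  (coverS u ->
     holomorphic_on (complex_structure H u) U f <->
     (forall p, U p -> differential_at f p *m P_S H (zetaS u) p = 0)) /\
  ((coverN `&` coverS) u ->
     holomorphic_on (complex_structure H u) U f <->
     (forall p, U p -> differential_at f p *m I_zeta H (zetaN u) p = 0)).
Proof.
case: u u_S2 => [[x y] z] u_S2.
have uu : x%:C ^+ 2 + y%:C ^+ 2 + z%:C ^+ 2 = 1.
  by rewrite -!(rmorphXn (real_complex R)) -!(rmorphD (real_complex R)) u_S2.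
have neq0C (a : R) : a != 0 -> a%:C != 0.
  by rewrite (fmorph_eq0 (real_complex R)).
have transfer (B : M -> 'M[R[i]]_(4 * m)) :
    (forall p (alpha : 'rV_(4 * m)),
       alpha *m (1%:M + 'i *: cplx (complex_structure H (x, y, z) p)) = 0 <->
       alpha *m B p = 0) ->
    holomorphic_on (complex_structure H (x, y, z)) U f <->
    (forall p, U p -> differential_at f p *m B p = 0).
  by move=> ker; rewrite holomorphic_onE; split=> h p /h /ker.
split=> [/coverN_neq0 zN|];
  [|split=> [/coverS_neq0 zS|[/coverN_neq0 zN /coverS_neq0 zS]]];
  apply: transfer => p alpha; rewrite -proj01_complex_structure.
- rewrite (quat_P_N _ _ _ (sqr_i R) (zetaN (x, y, z)) : P_N H _ p = _).
  apply: (quatN_kernel (cplxI11 H p) (cplxI22 H p) (cplxI33 H p) (cplxI123 H p)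
    (sqr_i R) _ uu _ (zetaNE x y zN)).
  by rewrite -[1 + z%:C](rmorphD (real_complex R)) neq0C.
- rewrite (quat_P_S _ _ _ (sqr_i R) (zetaS (x, y, z)) : P_S H _ p = _).
  apply: (quatS_kernel (cplxI11 H p) (cplxI22 H p) (cplxI33 H p) (cplxI123 H p)
    (sqr_i R) _ uu _ (zetaSE x y zS)).
  by rewrite -[1 - z%:C](rmorphB (real_complex R)) neq0C.
rewrite (quat_I_zeta _ _ _ (sqr_i R) (zetaN (x, y, z)) : I_zeta H _ p = _).
apply: (quat_I_zeta_kernel (cplxI11 H p) (cplxI22 H p) (cplxI33 H p)
  (cplxI123 H p) (sqr_i R) _ uu _ _ (zetaNE x y zN)).
- by rewrite -[1 + z%:C](rmorphD (real_complex R)) neq0C.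
- by rewrite -[1 - z%:C](rmorphB (real_complex R)) neq0C.
Qed.
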